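(* Let $n,m\ge 2$, let $G=B(n,m)$ be the broom graph on the vertex set $V(G)=\{x_1,\ldots,x_n,y_1,\ldots,y_m\}$, and let $NI(G^2)\subset S=K[V(G)]$ be the closed neighborhood ideal of the square of $G$. Then the height of $NI(G^2)$ is $$\operatorname{ht} NI(G^2)=\left\lceil\frac{m+1}{5}\right\rceil.$$
   Context: $K$ is a field. For $n,m\ge 2$, the broom graph $G=B(n,m)$ is the simple graph with vertex set $V(G)=\{x_1,\ldots,x_n,y_1,\ldots,y_m\}$ and edge set $E(G)=\{\{x_i,y_1\}:1\le i\le n\}\cup\{\{y_j,y_{j+1}\}:1\le j\le m-1\}$. Its square $G^2$ is the graph on the same vertex set with edge set $E(G^2)=E(G)\cup\{\{x_i,x_j\}:1\le i<j\le n\}\cup\{\{x_i,y_2\}:1\le i\le n\}\cup\{\{y_j,y_{j+2}\}:1\le j\le m-2\}$. For a simple graph $H$ and a vertex $u$, the closed neighborhood is $N[u]=\{u\}\cup\{v:\{u,v\}\in E(H)\}$. The closed neighborhood ideal $NI(H)$ is the squarefree monomial ideal of the polynomial ring $K[V(H)]$ (whose variables are the vertices) generated by the monomials $\prod_{v\in N[u]}v$, for $u\in V(H)$. *)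

(* Defs.v *)
From mathcomp Require Import all_boot all_order all_algebra.
From mathcomp Require Import mpoly.

Set Implicit Arguments.
Unset Strict Implicit.
Unset Printing Implicit Defensive.

Import GRing.Theory.
Local Open Scope ring_scope.

Section Height.
Variable R : comNzRingType.
Implicit Types (P Q : {pred R}) (I : R -> Prop) (C : nat -> {pred R}).

(* Prime ideals are boolean predicates, as in ring_quotient; classically these
   are all the prime ideals.  [idealr_closed] includes properness. *)
Definition prime_ideal P : Prop := idealr_closed P /\ prime_idealr_closed P.

Definition strict_sub P Q : Prop :=
  {subset P <= Q} /\ exists2 f, f \in Q & f \notin P.

(* C 0 < C 1 < ... < C l = P; the values of C beyond l are irrelevant. *)
Definition prime_chain_to P (l : nat) C : Prop :=
  [/\ forall i : nat, (i <= l)%N -> prime_ideal (C i),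
      forall i : nat, (i < l)%N -> strict_sub (C i) (C i.+1)
    & C l =i P].

(* Relational, so that a prime of infinite height has no height h. *)
Definition prime_height P (h : nat) : Prop :=
  (exists C, prime_chain_to P h C) /\
  (forall l C, prime_chain_to P l C -> (l <= h)%N).

Definition prime_over I P : Prop := prime_ideal P /\ forall f, I f -> f \in P.

(* The height of I is the least height of a prime ideal containing I. *)
Definition ideal_height I (h : nat) : Prop :=
  (exists2 P, prime_over I P & prime_height P h) /\
  (forall P k, prime_over I P -> prime_height P k -> (h <= k)%N).

Lemma ideal_height_uniq I (h k : nat) :
  ideal_height I h -> ideal_height I k -> h = k.
Proof.
move=> [[P IP Ph] hmin] [[Q IQ Qk] kmin].
by apply/eqP; rewrite eqn_leq (hmin Q) // (kmin P).
Qed.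

Definition ideal_gen (T : finType) (g : T -> R) : R -> Prop :=
  fun f => exists c : T -> R, f = \sum_u c u * g u.

End Height.

Section ClosedNeighborhoodIdeal.
Variables (K : fieldType) (T : finType) (e : rel T).

Definition closed_nbhd (u : T) : {set T} := u |: [set v | e u v].

(* K[T] is {mpoly K[#|T|]}; the variable of v is the one indexed by its rank. *)
Definition vertex_var (v : T) : {mpoly K[#|T|]} := 'X_(enum_rank v).

Definition closed_nbhd_ideal : {mpoly K[#|T|]} -> Prop :=
  ideal_gen (fun u : T => \prod_(v in closed_nbhd u) vertex_var v).

End ClosedNeighborhoodIdeal.

Section Broom.
Variables n m : nat.

(* inl i is x_(i+1) and inr j is y_(j+1), as ordinals start at 0. *)
Definition broom_vertex : finType := ('I_n + 'I_m)%type.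

Definition broom : rel broom_vertex := fun u v =>
  match u, v with
  | inl _, inl _ => false
  | inl _, inr j | inr j, inl _ => j == 0%N :> nat
  | inr j, inr k => (k == j.+1 :> nat) || (j == k.+1 :> nat)
  end.

Definition broom_sq : rel broom_vertex := fun u v =>
  broom u v ||
  match u, v with
  | inl i, inl j => i != j
  | inl _, inr j | inr j, inl _ => j == 1%N :> nat
  | inr j, inr k => (k == j.+2 :> nat) || (j == k.+2 :> nat)
  end.

Lemma broom_sym : ssrbool.symmetric broom.
Proof. by case=> i [] j //=; rewrite orbC. Qed.

Lemma broom_irr : irreflexive broom.
Proof. by case=> i //=; rewrite orbb ltn_eqF. Qed.

Lemma broom_sq_sym : ssrbool.symmetric broom_sq.
Proof.
move=> u v; rewrite /broom_sq broom_sym; congr (_ || _).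
by case: u v => i [] j //=; rewrite 1?eq_sym // orbC.
Qed.

Lemma broom_sq_irr : irreflexive broom_sq.
Proof.
by move=> u; rewrite /broom_sq broom_irr; case: u => i /=;
  rewrite ?eqxx // orbb ltn_eqF.
Qed.

Lemma broom_sqE (u v : broom_vertex) : (0 < m)%N ->
  broom_sq u v =
    (u != v) && (broom u v || [exists w, broom u w && broom w v]).
Proof.
move=> m_gt0; apply/idP/idP.
  move=> uv; have -> /= : u != v by apply: contraTneq uv => ->; rewrite broom_sq_irr.
  case/orP: uv => [-> // | uv]; apply/orP; right; apply/existsP.
  case: u v uv => i [] j /=.
  - by move=> _; exists (inr (Ordinal m_gt0)).
  - by move=> /eqP j1; exists (inr (Ordinal m_gt0)); rewrite /= j1.
  - by move=> /eqP i1; exists (inr (Ordinal m_gt0)); rewrite /= i1.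
  - case/orP=> /eqP ij.
      have lt : (i.+1 < m)%N by apply: leq_trans (ltn_ord j); rewrite ij.
      by exists (inr (Ordinal lt)); rewrite /= ij !eqxx.
    have lt : (j.+1 < m)%N by apply: leq_trans (ltn_ord i); rewrite ij.
    by exists (inr (Ordinal lt)); rewrite /= ij !eqxx !orbT.
case/andP=> neq_uv /orP [uv | /existsP [w]]; first by rewrite /broom_sq uv.
rewrite /broom_sq; case: u v w neq_uv => i [] j [] k //= neq_uv.
- by case/andP=> /eqP -> /orP [] /eqP; [move=> ->; rewrite orbT|].
- by rewrite andbF.
- by case/andP=> /[swap] /eqP -> /orP [] /eqP; [|move=> ->; rewrite orbT].
- case/andP=> /eqP i0 /eqP j0; case/eqP: neq_uv; congr inr.
  by apply: val_inj => /=; rewrite i0 j0.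
- case/andP=> /orP [] /eqP ik /orP [] /eqP jk.
  + by rewrite jk ik eqxx /= orbT.
  + by case/eqP: neq_uv; congr inr; apply: val_inj => /=; move: jk; rewrite ik => -[].
  + by case/eqP: neq_uv; congr inr; apply: val_inj => /=; rewrite ik jk.
  + by rewrite ik jk eqxx !orbT.
Qed.

End Broom.

(* Main.v *)
Require Import Defs.
From mathcomp Require Import all_boot all_order all_algebra.
From mathcomp Require Import mpoly.
From mathcomp Require Import zify ring.

Set Implicit Arguments.
Unset Strict Implicit.
Unset Printing Implicit Defensive.

Import Order.TTheory GRing.Theory Num.Theory.

(** The height of an ideal generated by squarefree monomials is the least size
of a set of variables that meets every generator: a prime containing a
monomial contains one of its variables, so the primes over the ideal are those
that contain all the variables of such a hitting set, and the ideal generated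
by a set [S] of variables is a prime of height [#|S|].

That this height is at least [#|S|] is seen by killing the variables of [S] one
at a time; the same chain, ending at any other prime that contains these
variables, shows that such a prime has height at least [#|S|].  For the upper
bound, a chain of primes ending at the ideal of [S] can be prolonged by adding
the other variables one at a time, so it is enough to know that no chain of
primes in [K[x_1, ..., x_N]] is longer than [N] ([prime_chain_le_dim]).  Two
facts give this.  If each of [N + 1] successive steps of a chain of primes picks
up a new element, these elements satisfy no polynomial relation over [K]
([prime_chain_indep]): reading a relation modulo larger and larger primes of the
chain isolates its lexicographically least monomial.  But any [N + 1]
polynomials in [N] variables are algebraically dependent
([mpoly_alg_dependent]): they have [D ^ (N + 1)] monomials with exponents less
than [D], and these lie in a space whose dimension grows only like [D ^ N].

For a closed neighborhood ideal the hitting sets are the dominating sets.  In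
the broom give every [x_i] the position 0 and [y_j] the position [j]: two
vertices are equal or adjacent in the square exactly when their positions differ
by at most 2.  So one vertex dominates at most 5 of the [m + 1] positions, and
the vertices at positions 2, 7, 12, ... (the last one moved back to [m] if it
would exceed it) dominate all of them. *)

(** * Primes in a commutative ring *)

Section PrimeIdeals.
Local Open Scope ring_scope.
Variable R : comNzRingType.
Implicit Types P Q : {pred R}.

Lemma primeD P f g : prime_ideal P -> f \in P -> g \in P -> f + g \in P.
Proof. by case=> [[_ _ PD] _] Pf Pg; rewrite -[f]mul1r PD. Qed.

Lemma primeMl P f g : prime_ideal P -> g \in P -> f * g \in P.
Proof. by case=> [[P0 _ PD] _] Pg; rewrite -[_ * _]addr0 PD. Qed.

Lemma primeB P f g : prime_ideal P -> f \in P -> g \in P -> f - g \in P.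
Proof. by move=> Pp Pf Pg; rewrite -mulN1r primeD ?primeMl. Qed.

Lemma prime_sum P (T : Type) (r : seq T) (A : pred T) (F : T -> R) :
  prime_ideal P -> (forall t, A t -> F t \in P) -> \sum_(t <- r | A t) F t \in P.
Proof.
move=> Pp PF; elim/big_rec: _ => [|t f At Pf]; first by case: Pp => [[]].
by rewrite primeD ?PF.
Qed.

Lemma prime_prod P (T : finType) (A : pred T) (F : T -> R) :
  prime_ideal P -> \prod_(t | A t) F t \in P -> exists2 t, A t & F t \in P.
Proof.
move=> [[_ P1 _] Pm]; elim/big_rec: _ => [|t f At IH]; first by rewrite (negPf P1).
by case/Pm/orP => [Ft|/IH //]; exists t.
Qed.

Lemma prime_exp P f k : prime_ideal P -> f ^+ k \in P -> f \in P.
Proof.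
move=> [[_ P1 _] Pm]; elim: k => [|k IH]; first by rewrite expr0 (negPf P1).
by rewrite exprS => /Pm /orP[|/IH].
Qed.

Lemma unit_notin_prime P f : prime_ideal P -> (exists g, g * f = 1) -> f \notin P.
Proof.
move=> Pp [g gf1]; apply/negP => Pf; have := primeMl g Pp Pf.
by rewrite gf1; case: Pp => [[_ /negPf ->]].
Qed.

(** Since [a i] lies outside [P i] but in [P i.+1], a relation in [P i] can be
divided by the least power of [a i] that occurs, after which the monomials
still divisible by [a i] vanish modulo [P i.+1].  Once all the [a i] have been
treated, a single coefficient is left, and it lies in [P d].  The set [A] in the
proof collects the exponents that have survived the first [j] steps. *)
Lemma prime_chain_indep d D (P : nat -> {pred R}) (a : 'I_d -> R)
    (u : {ffun 'I_d -> 'I_D} -> R) :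
  (forall i, (i <= d)%N -> prime_ideal (P i)) ->
  (forall i : 'I_d, {subset P i <= P i.+1}) ->
  (forall i : 'I_d, a i \in P i.+1) -> (forall i : 'I_d, a i \notin P i) ->
  (forall t, u t != 0 -> u t \notin P d) ->
  \sum_t u t * \prod_i a i ^+ t i = 0 -> forall t, u t = 0.
Proof.
move=> Pp sP aP aN uP sum0 t0; apply/eqP; apply: contraT => ut0.
pose tail (j : nat) (t : {ffun 'I_d -> 'I_D}) :=
  \prod_(i < d | (j <= i)%N) a i ^+ t i.
suff step j : (j <= d)%N -> exists A : {set {ffun 'I_d -> 'I_D}},
    [/\ A != set0, (forall t, t \in A -> u t != 0),
        (forall s t, s \in A -> t \in A ->
           forall i : 'I_d, (i < j)%N -> s i = t i)
      & \sum_(t in A) u t * tail j t \in P j].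
  have [A [/set0Pn[t tA] Au Aeq]] := step d (leqnn d).
  rewrite (_ : A = [set t]) ?big_set1.
    rewrite /tail big_pred0 ?mulr1; last by move=> i; rewrite leqNgt ltn_ord.
    by rewrite (negPf (uP t (Au t tA))).
  apply/setP => s; rewrite inE; apply/idP/eqP => [sA | -> //].
  by apply/ffunP => i; apply: Aeq.
elim: j => [|j IH] jd.
  exists [set t | u t != 0]; split.
  - by apply/set0Pn; exists t0; rewrite inE.
  - by move=> t; rewrite inE.
  - by [].
  have -> : \sum_(t in [set t | u t != 0]) u t * tail 0 t = 0.
    rewrite -[RHS]sum0 [RHS](bigID (fun t => u t != 0)) /= [X in _ = _ + X]big1.
      by rewrite addr0; apply: eq_bigl => t; rewrite inE.
    by move=> t; rewrite negbK => /eqP ->; rewrite mul0r.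
  by have [[]] := Pp 0%N (leq0n d).
have [A [/set0Pn[s sA] Au Aeq Asum]] := IH (ltnW jd).
pose o := Ordinal jd.
case: (@arg_minnP _ s (mem A) (fun t : {ffun 'I_d -> 'I_D} => t o : nat) sA) => r.
rewrite -[mem A r]/(r \in A) => rA rmin.
have tailE t : tail j t = a o ^+ t o * tail j.+1 t.
  rewrite /tail (bigD1 o) //=; congr (_ * _); apply: eq_bigl => i.
  by rewrite -val_eqE /= ltn_neqAle eq_sym andbC.
have sumE : \sum_(t in A) u t * tail j t =
    a o ^+ r o * \sum_(t in A) a o ^+ (t o - r o) * (u t * tail j.+1 t).
  rewrite big_distrr; apply: eq_bigr => t tA /=.
  by rewrite [RHS]mulrA -exprD subnKC ?rmin // tailE mulrCA.
have [_ Pm] := Pp j (ltnW jd).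
have Pj1 := Pp j.+1 jd.
have {Asum}: \sum_(t in A) a o ^+ (t o - r o) * (u t * tail j.+1 t) \in P j.+1.
  apply: (sP o); rewrite sumE in Asum.
  case/Pm/orP: Asum => // /(prime_exp (Pp j (ltnW jd))).
  by rewrite (negPf (aN o)).
rewrite (bigID (fun t : {ffun 'I_d -> 'I_D} => t o == r o)) /= => Asum.
exists [set t in A | t o == r o]; split.
- by apply/set0Pn; exists r; rewrite inE rA eqxx.
- by move=> t; rewrite inE => /andP[/Au].
- move=> t t'; rewrite !inE => /andP[tA /eqP to] /andP[tA' /eqP to'] i.
  rewrite ltnS leq_eqVlt => /orP[/eqP ij | ]; last exact: Aeq.
  by rewrite (_ : i = o) ?to ?to' //; apply: val_inj.
have -> : \sum_(t in [set t in A | t o == r o]) u t * tail j.+1 t =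
    \sum_(t in A | t o == r o) a o ^+ (t o - r o) * (u t * tail j.+1 t).
  apply: eq_big => t; first by rewrite inE.
  by rewrite inE => /andP[_ /eqP ->]; rewrite subnn mul1r.
(* The terms with a larger exponent of [a o] lie in [P j.+1], so they can go. *)
rewrite -[X in X \in _](addrK (\sum_(t in A | t o != r o)
  a o ^+ (t o - r o) * (u t * tail j.+1 t))) primeB //.
apply: prime_sum => // t /andP[tA tr].
have lt_rt : (r o < t o)%N by rewrite ltn_neqAle eq_sym tr rmin.
rewrite -(subnK lt_rt) addnS -addSn addnK exprSr -mulrA.
by rewrite primeMl // mulrC primeMl ?aP.
Qed.

Definition chain_rcons (C : nat -> {pred R}) l Q : nat -> {pred R} :=
  fun i => if (i <= l)%N then C i else Q.

Lemma prime_chain_rcons P Q l C : prime_chain_to P l C -> prime_ideal Q ->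
  strict_sub P Q -> prime_chain_to Q l.+1 (chain_rcons C l Q).
Proof.
move=> [Cp Cs CP] Qp [PQ [f fQ fP]]; rewrite /chain_rcons; split => [i|i|f'].
- by case: ifP => [il _ | _ _]; [apply: Cp | apply: Qp].
- rewrite ltnS => il; rewrite il; case: (ltnP i l) => [|li]; first exact: Cs.
  have -> : i = l by lia.
  by split=> [g|]; [rewrite CP; apply: PQ | exists f; rewrite ?CP].
- by rewrite ltnn.
Qed.

End PrimeIdeals.

(** * Chains of primes in a polynomial ring *)

Section KrullDimension.
Local Open Scope ring_scope.
Variables (K : fieldType) (N : nat).
Local Notation R := {mpoly K[N]}.

Lemma msize_exp_prod d (f : 'I_d -> R) (t : 'I_d -> nat) e D :
  (forall i, (msize (f i) <= e.+1)%N) -> (forall i, (t i <= D)%N) ->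
  (msize (\prod_i f i ^+ t i) <= (d * (D * e)).+1)%N.
Proof.
have sizeM p q k l : (msize (p : R) <= k.+1)%N -> (msize (q : R) <= l.+1)%N ->
    (msize (p * q)%R <= (k + l).+1)%N.
  have [->|p0] := eqVneq p 0; first by rewrite mul0r msize0.
  have [->|q0] := eqVneq q 0; first by rewrite mulr0 msize0.
  rewrite msizeM // => pk ql; rewrite -subn1 leq_subLR.
  by apply: leq_trans (leq_add pk ql) _; rewrite addSn addnS.
move=> fe tD; rewrite -[d in (d * _)%N]card_ord -sum_nat_const.
elim/big_rec2: _ => [|i k p _ IH]; first by rewrite msize1.
apply: (sizeM) => //; apply: leq_trans (_ : (t i * e).+1 <= _)%N; last first.
  by rewrite ltnS leq_mul2r tD orbT.
elim: (t i) => [|k' IH']; first by rewrite expr0 msize1.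
by rewrite exprS mulSn; apply: sizeM.
Qed.

Lemma mpoly_eq0_box B (p : R) : (msize p <= B)%N ->
  (forall t : {ffun 'I_N -> 'I_B}, p@_[multinom t i : nat | i < N] = 0) -> p = 0.
Proof.
move=> pB p0; apply/mpolyP => m; rewrite mcoeff0.
have [/msize_mdeg_lt m_lt | /memN_msupp_eq0 //] := boolP (m \in msupp p).
have mB := leq_trans m_lt pB.
have lt_m i : (m i < B)%N.
  by apply: leq_ltn_trans mB; rewrite mdegE (bigD1 i) //= leq_addr.
rewrite -[RHS](p0 [ffun i => Ordinal (lt_m i)]); congr mcoeff.
by apply/mnmP => i; rewrite mnmE ffunE.
Qed.

(** A counting argument.  The coefficients of the monomials in the [f i] with
exponents below [D] form a matrix with [D ^ N.+1] rows and [B ^ N] columns,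
where [B] bounds the degrees and is linear in [D]; once there are more rows than
columns, the rows are linearly dependent. *)
Lemma mpoly_alg_dependent (f : 'I_N.+1 -> R) :
  exists D (u : {ffun 'I_N.+1 -> 'I_D} -> K),
    (exists t, u t != 0) /\ \sum_t u t *: \prod_i f i ^+ t i = 0.
Proof.
(* [B <= (N.+1 * e).+1 * D], so it is enough that [D] exceeds the [N]th power of
   the first factor. *)
pose e := \max_i msize (f i); pose D := ((N.+1 * e).+1 ^ N + 1)%N.
pose B := (N.+1 * (D * e)).+1.
pose I := {ffun 'I_N.+1 -> 'I_D}; pose J := {ffun 'I_N -> 'I_B}.
pose mon (t : I) := \prod_i f i ^+ t i.
pose A := \matrix_(r < #|I|, c < #|J|)
  (mon (enum_val r))@_[multinom (enum_val c : J) i : nat | i < N].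
have lt_JI : (#|J| < #|I|)%N.
  rewrite !card_ffun !card_ord.
  have BD : (B <= (N.+1 * e).+1 * D)%N by rewrite /B /D; nia.
  have expBD k : (B ^ k <= ((N.+1 * e).+1 * D) ^ k)%N.
    by case: k => // k; rewrite leq_exp2r.
  apply: leq_ltn_trans (expBD N) _.
  rewrite expnMn expnS ltn_pmul2r ?expn_gt0 ?/D; lia.
have : kermx A != 0.
  by rewrite kermx_eq0 -row_leq_rank -ltnNge (leq_ltn_trans (rank_leq_col A)).
case/rowV0Pn => v /sub_kermxP vA0 /rV0Pn[r vr].
exists D, (fun t => v 0 (enum_rank t)); split.
  by exists (enum_val r); rewrite enum_valK.
apply: (@mpoly_eq0_box B) => [|s].
  have size_sum (F : I -> R) : (forall t, (msize (F t) <= B)%N) ->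
      (msize (\sum_t F t) <= B)%N.
    move=> FB; elim/big_rec: _ => [|t p _ pB]; first by rewrite msize0.
    by apply: leq_trans (msizeD_le _ _) _; rewrite geq_max FB.
  apply: size_sum => t; apply: leq_trans (msizeZ_le _ _) _.
  apply: msize_exp_prod => i; last exact: ltnW.
  by rewrite leqW // /e (bigD1 i) //= leq_maxl.
have /rowP/(_ (enum_rank s)) := vA0; rewrite !mxE => vA.
rewrite raddf_sum /= -[RHS]vA (reindex (@enum_val I predT)) /=; last first.
  exact/onW_bij/enum_val_bij.
by apply: eq_bigr => t _; rewrite mcoeffZ enum_valK mxE enum_rankK.
Qed.

(** The Krull dimension of a polynomial ring in [N] variables over a field is at
most [N]: elements picked at [N.+1] strict inclusions would be both dependent
and independent. *)
Lemma prime_chain_le_dim P l C : @prime_chain_to R P l C -> (l <= N)%N.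
Proof.
move=> [Cp Cs _]; rewrite leqNgt; apply/negP => lt_Nl.
have lt_il (i : 'I_N.+1) : (i < l)%N by apply: leq_trans lt_Nl; apply: ltn_ord.
have /fin_all_exists[a aC] (i : 'I_N.+1) :
    exists f, (f \in C i.+1) && (f \notin C i).
  by have [_ [f f1 f2]] := Cs i (lt_il i); exists f; rewrite f1.
have [D [u [[t ut] sum0]]] := mpoly_alg_dependent a.
suff /eqP: (u t)%:MP = 0 :> R by rewrite mpolyC_eq0 (negPf ut).
apply: (@prime_chain_indep _ _ D C a (fun t => (u t)%:MP)).
- by move=> i iN; apply: Cp; apply: leq_trans iN _.
- by move=> i; case: (Cs i (lt_il i)).
- by move=> i; case/andP: (aC i).
- by move=> i; case/andP: (aC i).
- move=> s; rewrite mpolyC_eq0 => us; apply: unit_notin_prime; first exact: Cp.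
  by exists (u s)^-1%:MP; rewrite -mpolyCM mulVf.
- by rewrite -[RHS]sum0; apply: eq_bigr => s _; rewrite mul_mpolyC.
Qed.

End KrullDimension.

(** * Primes generated by variables, and the height of monomial ideals *)

Section CoordinatePrimes.
Local Open Scope ring_scope.
Variables (K : fieldType) (N : nat).
Local Notation R := {mpoly K[N]}.
Implicit Types (S : {set 'I_N}) (P : {pred R}).

Definition kill_vars S : N.-tuple R := [tuple if i \in S then 0 else 'X_i | i < N].

(** The ideal generated by the variables of [S], given as the kernel of the
substitution of 0 for them: this makes membership decidable and primality
immediate.  [coord_prime_min] relates it to the generators. *)
Definition coord_prime S : {pred R} := [pred f : R | f \mPo kill_vars S == 0].

Lemma kill_varsX S i : 'X_i \mPo kill_vars S = if i \in S then 0 else 'X_i.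
Proof. by rewrite comp_mpolyXU -tnth_nth tnth_mktuple. Qed.

Lemma mpolyX_neq0 i : 'X_i != 0 :> R.
Proof. by rewrite -msize_poly_eq0 msizeX. Qed.

Lemma coord_primeX S i : ('X_i \in coord_prime S) = (i \in S).
Proof.
by rewrite inE kill_varsX; case: ifP => // _; rewrite ?eqxx // (negPf (mpolyX_neq0 i)).
Qed.

Lemma coord_prime_prime S : prime_ideal (coord_prime S).
Proof.
split; last by move=> f g; rewrite !inE rmorphM mulf_eq0.
split=> [||f g h]; rewrite !inE ?rmorph0 ?rmorph1 ?oner_eq0 //.
by move=> /eqP g0 /eqP h0; rewrite rmorphD rmorphM /= g0 h0 mulr0 addr0.
Qed.

Lemma kill_vars_congr S P : prime_ideal P -> (forall i, i \in S -> 'X_i \in P) ->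
  forall f, f - (f \mPo kill_vars S) \in P.
Proof.
move=> Pp SP f; have P0 : 0 \in P by case: Pp => [[]].
have congM (g g' h h' : R) : g - g' \in P -> h - h' \in P -> g * h - g' * h' \in P.
  move=> gP hP; have -> : g * h - g' * h' = h * (g - g') + g' * (h - h') by ring.
  by rewrite primeD ?primeMl.
rewrite [f]mpolyE [X in _ - X]raddf_sum -sumrB; apply: prime_sum => // m _.
rewrite /= comp_mpolyZ -scalerBr -mul_mpolyC primeMl // comp_mpolyX mpolyXE_id.
elim/big_rec2: _ => [|i g h _ gh]; first by rewrite subrr.
apply: (congM) => //; elim: (m i) => [|k IH]; first by rewrite !expr0 subrr.
rewrite !exprS; apply: congM => //; rewrite tnth_mktuple.
by case: ifP => [/SP|]; rewrite ?subr0 ?subrr.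
Qed.

Lemma coord_prime_min S P : prime_ideal P -> (forall i, i \in S -> 'X_i \in P) ->
  {subset coord_prime S <= P}.
Proof.
by move=> Pp SP f /eqP f0; have := kill_vars_congr Pp SP f; rewrite f0 subr0.
Qed.

Lemma coord_prime_strict S P i : prime_ideal P -> i \notin S ->
  (forall j, j \in i |: S -> 'X_j \in P) -> strict_sub (coord_prime S) P.
Proof.
move=> Pp iS SP; split.
  by apply: coord_prime_min => // j jS; rewrite SP // in_setU1 jS orbT.
by exists 'X_i; rewrite ?SP ?setU11 ?coord_primeX.
Qed.

(** By induction on [S]: the chain to the ideal of [S :\ i] is completed by [P]
itself.  As [P] is arbitrary, this bounds below the height of every prime over
a monomial ideal, not only of the coordinate primes. *)
Lemma coord_chain_ge S P : prime_ideal P -> (forall i, i \in S -> 'X_i \in P) ->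
  exists C, prime_chain_to P #|S| C.
Proof.
move En: #|S| => k; elim: k S P En => [|k IH] S P cardS Pp SP.
  by exists (fun=> P); split.
have /card_gt0P[i iS] : (0 < #|S|)%N by rewrite cardS.
have cardSi : #|S :\ i| = k by move: cardS; rewrite (cardsD1 i) iS => -[].
have SiP j : j \in S :\ i -> 'X_j \in coord_prime (S :\ i) by rewrite coord_primeX.
have [C chC] := IH _ _ cardSi (coord_prime_prime _) SiP.
exists (chain_rcons C k P); apply: prime_chain_rcons (chC) (Pp) _.
by apply: (@coord_prime_strict _ _ i); rewrite ?setD11 ?setD1K.
Qed.

(** By induction on the complement of [S]: adding a variable prolongs the chain by
one step, until all variables are used and the dimension bound applies. *)
Lemma coord_chain_le S l C : prime_chain_to (coord_prime S) l C -> (l <= #|S|)%N.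
Proof.
move Ek: #|~: S| => k; elim: k S l C Ek => [|k IH] S l C cardS chC.
  by rewrite -[#|S|]addn0 -cardS cardsC card_ord; apply: prime_chain_le_dim chC.
have /card_gt0P[i] : (0 < #|~: S|)%N by rewrite cardS.
rewrite inE => iS; have cardU : #|i |: S| = #|S|.+1 by rewrite cardsU1 iS.
rewrite -ltnS -cardU; apply: IH; last first.
  apply: prime_chain_rcons chC (coord_prime_prime _) _.
  apply: (@coord_prime_strict _ _ i) (coord_prime_prime _) iS _ => j.
  by rewrite coord_primeX.
by move: (cardsC (i |: S)) (cardsC S); rewrite cardU cardS => <-; lia.
Qed.

Lemma coord_prime_height S : prime_height (coord_prime S) #|S|.
Proof.
split; last exact: coord_chain_le.
by apply: coord_chain_ge (coord_prime_prime S) _ => i; rewrite coord_primeX.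
Qed.

(** A coordinate prime contains the generators when its variables hit them all;
conversely the variables that lie in a prime over the ideal hit every generator,
and their number is at most the height of that prime. *)
Lemma monomial_ideal_height (T V : finType) (A : T -> {set V}) (x : V -> 'I_N) S :
  (forall u, exists2 v, v \in A u & x v \in S) ->
  (forall S', (forall u, exists2 v, v \in A u & x v \in S') ->
     (#|S| <= #|S'|)%N) ->
  ideal_height (ideal_gen (fun u => \prod_(v in A u) ('X_(x v) : R))) #|S|.
Proof.
move=> hitS minS; split.
  exists (coord_prime S); last exact: coord_prime_height.
  have Sp := coord_prime_prime S; split=> // f [c ->]; apply: prime_sum => // u _.
  have [v vA vS] := hitS u; rewrite primeMl // (bigD1 v) //= mulrC primeMl //.
  by rewrite coord_primeX.
move=> P k [Pp genP] [_ maxk].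
pose S' := [set i | ('X_i : R) \in P].
have [C chC] : exists C, prime_chain_to P #|S'| C.
  by apply: coord_chain_ge => // i; rewrite inE.
apply: leq_trans (maxk _ _ chC); apply: minS => u.
have /(prime_prod Pp)[v vA vP] : \prod_(v in A u) ('X_(x v) : R) \in P.
  apply: genP; exists (fun v => (v == u)%:R).
  rewrite (bigD1 u) //= eqxx mul1r [X in _ + X]big1 ?addr0 // => v /negPf ->.
  by rewrite mul0r.
by exists v; rewrite ?inE.
Qed.

End CoordinatePrimes.

(** * Domination in the square of a broom *)

Section ClosedNeighborhoods.
Variables (K : fieldType) (T : finType) (e : rel T).

Definition dominating (S : {set T}) :=
  forall u, exists2 v, v \in closed_nbhd e u & v \in S.

Lemma closed_nbhd_ideal_height (S : {set T}) : dominating S ->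
  (forall S', dominating S' -> #|S| <= #|S'|) ->
  ideal_height (@closed_nbhd_ideal K T e) #|S|.
Proof.
move=> domS minS; have rank_inj := @enum_rank_inj T.
rewrite -(card_imset _ rank_inj); apply: monomial_ideal_height => [u|S' hitS'].
  by have [v vu vS] := domS u; exists v; rewrite // imset_f.
rewrite card_imset // -(on_card_preimset (onW_bij _ (@enum_rank_bij T))).
by apply: minS => u; have [v vu vS'] := hitS' u; exists v; rewrite // inE.
Qed.

End ClosedNeighborhoods.

Section BroomDomination.
Variables n m : nat.
Local Notation V := (broom_vertex n m).

(** The distance to a vertex [x_i], except that the [x_i] are not told apart. *)
Definition broom_pos (v : V) : nat := if v is inr j then j.+1 else 0.

Lemma broom_pos_le v : broom_pos v <= m.
Proof. by case: v => //= j; apply: ltn_ord. Qed.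

Lemma broom_sq_nbhd (u v : V) :
  (v \in closed_nbhd (@broom_sq n m) u) =
  (broom_pos u <= broom_pos v + 2) && (broom_pos v <= broom_pos u + 2).
Proof.
rewrite !inE /broom_sq; case: u v => i [] j; rewrite /eq_op /= -?val_eqE /=; lia.
Qed.

(** The five positions around each vertex of [S] must cover [0, ..., m]. *)
Lemma dominating_broom_sq_ge (S : {set V}) : 0 < n ->
  dominating (@broom_sq n m) S -> m.+1 <= 5 * #|S|.
Proof.
move=> n_gt0 domS.
(* The positions covered by [v] are [broom_pos v - 2 + r] with [r < 5]. *)
pose cover (q : V * 'I_5) : 'I_m.+1 := inord (broom_pos q.1 + q.2 - 2).
have -> : 5 * #|S| = #|setX S [set: 'I_5]| by rewrite cardsX cardsT card_ord mulnC.
rewrite -[m.+1]card_ord -cardsT; apply: leq_trans (leq_imset_card cover _).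
apply: subset_leq_card; apply/subsetP => p _.
have [u pos_u] : exists u : V, broom_pos u = p.
  case: p => [[|p] lt_pm]; first by exists (inl (Ordinal n_gt0)).
  by exists (inr (Ordinal (lt_pm : p < m))).
have [v] := domS u; rewrite broom_sq_nbhd pos_u => /andP[pv vp] vS.
have lt5 : p + 2 - broom_pos v < 5 by lia.
apply/imsetP; exists (v, Ordinal lt5); first by rewrite !inE vS.
apply: val_inj; rewrite /cover /= inordK; have := ltn_ord p; lia.
Qed.

(** Position [p] is within 2 of the centre of its block of five consecutive
positions.  The last block may be truncated before its centre; its vertex is
then put at the last position [m]. *)
Lemma exists_dominating_broom_sq : 0 < m ->
  exists2 S : {set V}, dominating (@broom_sq n m) S & #|S| <= (m + 5) %/ 5.
Proof.
move=> m_gt0.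
(* [y_j] is [inr] of [j - 1], so position [5 * k + 2] is [inr (5 * k).+1]. *)
have lt_centre (k : 'I_((m + 5) %/ 5)) : minn (5 * k).+1 m.-1 < m by lia.
pose centre k : V := inr (Ordinal (lt_centre k)).
exists [set centre k | k in setT]; last first.
  by apply: leq_trans (leq_imset_card _ _) _; rewrite cardsT card_ord.
move=> u; have le_um := broom_pos_le u.
have lt_k : broom_pos u %/ 5 < (m + 5) %/ 5 by lia.
exists (centre (Ordinal lt_k)); last exact: imset_f.
by rewrite broom_sq_nbhd /=; lia.
Qed.

End BroomDomination.

Lemma ceil_divn5 m : (`|Num.ceil ((m.+1)%:R / 5%:R : rat)%R|)%N = (m + 5) %/ 5.
Proof.
have -> : Num.ceil ((m.+1)%:R / 5%:R : rat)%R = Posz ((m + 5) %/ 5); last by [].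
apply: ceil_def; rewrite intrB -!pmulrn.
rewrite ltr_pdivlMr // ler_pdivrMr // mulrBl ltrBlDr -!natrM -natrD.
by rewrite ltr_nat ler_nat; lia.
Qed.

Theorem theorem3p8 (K : fieldType) (n m : nat) (hn : (2 <= n)%N) (hm : (2 <= m)%N) :
  ideal_height (@closed_nbhd_ideal K (broom_vertex n m) (@broom_sq n m))
    `|Num.ceil ((m.+1)%:R / 5%:R : rat)%R|%N.
Proof.
have n_gt0 : 0 < n by apply: ltnW.
have [S domS cardS] := exists_dominating_broom_sq n (ltnW hm).
have ge_dom S' := @dominating_broom_sq_ge n m S' n_gt0.
have -> : `|Num.ceil ((m.+1)%:R / 5%:R : rat)%R|%N = #|S|.
  by rewrite ceil_divn5; have := ge_dom S domS; lia.
apply: closed_nbhd_ideal_height => // S' /ge_dom; lia.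
Qed.
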